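(* Let $\mathfrak{g}$ be a finite-dimensional simple Lie algebra over $\mathbb{C}$, let $k$ be a real number, and let $V = L_k(\mathfrak{g})$ be the simple affine vertex operator algebra of level $k$ associated with $\mathfrak{g}$. Let $Y_1 : V\otimes V\to V((x))$ be a first-order deformation of $V$. Suppose that for every $a,b\in\mathfrak{g}$ the series $Y_1(a(-1)\mathbf{1},x)\,b(-1)\mathbf{1}$ is regular, i.e. contains no negative powers of $x$. Then $Y_1$ is a trivial first-order deformation of $V$.
   Context: Affine vertex algebras. $\langle\cdot,\cdot\rangle$ is the invariant symmetric bilinear form on $\mathfrak{g}$ normalized so that long roots have squared length $2$. $V^k(\mathfrak{g})$ is the universal affine vertex operator algebra of level $k$: it is generated by the fields $Y(a(-1)\mathbf{1},x)=\sum_{n\in\mathbb{Z}}a(n)x^{-n-1}$, $a\in\mathfrak{g}$, with $[a(m),b(n)]=[a,b](m+n)+m\,\delta_{m+n,0}\langle a,b\rangle k$ and $a(n)\mathbf{1}=0$ for $n\ge 0$, and is linearly spanned by the vectors $a_1(-n_1)\cdots a_r(-n_r)\mathbf{1}$ with $n_i\ge 1$, such a vector having conformal weight $n_1+\cdots+n_r$. $L_k(\mathfrak{g})$ is the simple quotient of $V^k(\mathfrak{g})$ (by the maximal proper graded ideal), with vertex operator $Y$ and vacuum $\mathbf{1}$. Notation. For a vertex algebra $(V,Y,\mathbf{1})$, write $Y(u,x)v=\sum_{n\in\mathbb{Z}}u_n v\,x^{-n-1}$, let $\mathrm{wt}$ denote conformal weight, and let $D:V\to V$, $Dv=v_{-2}\mathbf{1}$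 (that is, $D=L(-1)$). $\delta(x)=\sum_{n\in\mathbb{Z}}x^n$, and binomial expressions such as $(x_1-x_2)^n$ are expanded in nonnegative integer powers of the second variable. First-order deformation. A first-order deformation of $V$ is a linear map $Y_1:V\otimes V\to V((x))$, $Y_1(u,x)v=\sum_{n\in\mathbb{Z}}u_n^{def}v\,x^{-n-1}$, such that $\mathbb{C}[t]/(t^2)\otimes_{\mathbb{C}}V$ with vertex operator $Y+tY_1$ (extended $\mathbb{C}[t]/(t^2)$-bilinearly) and vacuum $\mathbf{1}$ is a grading-restricted vertex algebra over $\mathbb{C}[t]/(t^2)$. Equivalently: (1) $\mathrm{wt}(u_n^{def}v)=\mathrm{wt}\,u-n-1+\mathrm{wt}\,v$ for homogeneous $u,v\in V$ and $n\in\mathbb{Z}$; (2) $Y_1(\mathbf{1},x)v=0$ and $Y_1(v,x)\mathbf{1}=0$ for all $v\in V$; (3) $[D,Y_1(u,x)]v=Y_1(Du,x)v=\frac{d}{dx}Y_1(u,x)v$ for all $u,v\in V$; (4) for all $u,v\in V$, as operators on $V$, $$x_0^{-1}\delta\left(\tfrac{x_1-x_2}{x_0}\right)\bigl(Y_1(u,x_1)Y(v,x_2)+Y(u,x_1)Y_1(v,x_2)\bigr)-x_0^{-1}\delta\left(\tfrac{-x_2+x_1}{x_0}\right)\bigl(Y_1(v,x_2)Y(u,x_1)+Y(v,x_2)Y_1(u,x_1)\bigr)$$ $$=x_2^{-1}\delta\left(\tfrac{x_1-x_0}{x_2}\right)\bigl(Y_1(Y(u,x_0)v,x_2)+Y(Y_1(u,x_0)v,x_2)\bigr).$$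 Trivial deformation. A first-order deformation $Y_1$ is trivial if there is a grading-preserving $\mathbb{C}$-linear map $\phi:V\to V$ with $\phi(\mathbf{1})=0$ such that $Y_1(u,x)v=Y(\phi(u),x)v-\phi(Y(u,x)v)+Y(u,x)\phi(v)$ for all $u,v\in V$. *)

(* Defs.v *)
From HB Require Import structures.
From mathcomp Require Import all_boot all_order all_algebra.
From mathcomp Require Import complex reals.

Set Implicit Arguments.
Unset Strict Implicit.
Unset Printing Implicit Defensive.

Import Order.TTheory GRing.Theory Num.Theory.
Local Open Scope ring_scope.

(** * Finite-dimensional simple Lie algebras *)

Record is_lie_bracket (K : numFieldType) (g : vectType K) (br : g -> g -> g) :
    Prop := IsLieBracket {
  lie_linear_r : forall x, linear (br x);
  lie_linear_l : forall y, linear (br^~ y);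
  lie_alternating : forall x, br x x = 0;
  lie_jacobi : forall x y z, br x (br y z) + br y (br z x) + br z (br x y) = 0
}.

Definition is_lie_ideal (K : numFieldType) (g : vectType K)
    (br : g -> g -> g) (I : {vspace g}) : Prop :=
  forall x y, y \in I -> br x y \in I.

Record is_simple_lie (K : numFieldType) (g : vectType K) (br : g -> g -> g) :
    Prop := IsSimpleLie {
  simple_lie_bracket : is_lie_bracket br;
  simple_lie_nonabelian : exists x y, br x y != 0;
  simple_lie_ideals :
    forall I : {vspace g}, is_lie_ideal br I -> I = 0%VS \/ I = fullv
}.

(** Nilpotent self-normalizing subalgebra. *)
Record is_cartan (K : numFieldType) (g : vectType K) (br : g -> g -> g)
    (h : {vspace g}) : Prop := IsCartan {
  cartan_subalgebra : forall x y, x \in h -> y \in h -> br x y \in h;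
  cartan_nilpotent : exists n : nat, forall (s : seq g) (y : g),
    size s = n -> {subset s <= h} -> y \in h -> foldr br y s = 0;
  cartan_self_normalizing :
    forall x, (forall y, y \in h -> br x y \in h) -> x \in h
}.

Definition is_root (K : numFieldType) (g : vectType K) (br : g -> g -> g)
    (h : {vspace g}) (alpha : 'Hom(subvs_of h, K^o)) : Prop :=
  alpha != 0 /\
  exists2 x : g, x != 0 &
    forall y : subvs_of h, br (vsval y) x = (alpha y : K) *: x.

Record is_invariant_form (K : numFieldType) (g : vectType K)
    (br : g -> g -> g) (form : g -> g -> K) : Prop := IsInvariantForm {
  form_linear_r : forall x, scalar (form x);
  form_sym : forall x y, form x y = form y x;
  form_invariant : forall x y z, form (br x y) z = form x (br y z)
}.

(** [t] is the element of [h] corresponding to [alpha] in the dual of [h] under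
    [form], so that the squared length of [alpha] is [form t t]. *)
Definition form_dual (K : numFieldType) (g : vectType K)
    (form : g -> g -> K) (h : {vspace g}) (alpha : 'Hom(subvs_of h, K^o))
    (t : g) : Prop :=
  t \in h /\ forall y : subvs_of h, form t (vsval y) = alpha y.

Definition is_long_root (K : numFieldType) (g : vectType K)
    (br : g -> g -> g) (form : g -> g -> K) (h : {vspace g})
    (alpha : 'Hom(subvs_of h, K^o)) : Prop :=
  is_root br alpha /\
  forall (beta : 'Hom(subvs_of h, K^o)) (s t : g), is_root br beta ->
    form_dual form beta s -> form_dual form alpha t -> form s s <= form t t.

(** All long roots have the same squared length, hence it is enough to say that
    one of them has squared length 2; this also excludes [form = 0]. *)
Definition is_normalized_form (K : numFieldType) (g : vectType K)
    (br : g -> g -> g) (form : g -> g -> K) : Prop :=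
  is_invariant_form br form /\
  exists2 h : {vspace g}, is_cartan br h &
    exists (alpha : 'Hom(subvs_of h, K^o)) (t : g),
      [/\ is_long_root br form alpha, form_dual form alpha t & form t t = 2].

(** * Grading-restricted vertex algebras *)

Definition is_subspace (K : numFieldType) (V : lmodType K) (S : V -> Prop) :
    Prop :=
  S 0 /\ forall (a : K) u v, S u -> S v -> S (a *: u + v).

Definition is_finite_dim (K : numFieldType) (V : lmodType K) (S : V -> Prop) :
    Prop :=
  exists (d : nat) (e : 'I_d -> V), forall v, S v ->
    exists c : 'I_d -> K, v = \sum_(i < d) c i *: e i.

Definition in_span (K : numFieldType) (V : lmodType K) (S : V -> Prop) (v : V) :
    Prop :=
  exists (d : nat) (e : 'I_d -> V) (c : 'I_d -> K),
    (forall i, S (e i)) /\ v = \sum_(i < d) c i *: e i.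

(** V is the direct sum of the subspaces [G n], n in Z. *)
Record is_grading (K : numFieldType) (V : lmodType K) (G : int -> V -> Prop) :
    Prop := IsGrading {
  grading_subspace : forall n, is_subspace (G n);
  grading_sum : forall v, exists (s : seq int) (f : int -> V),
    (forall n, G n (f n)) /\ v = \sum_(n <- s) f n;
  grading_direct : forall (s : seq int) (f : int -> V), uniq s ->
    (forall n, G n (f n)) -> \sum_(n <- s) f n = 0 ->
    forall n, n \in s -> f n = 0
}.

(** The binomial coefficient m (m - 1) ... (m - i + 1) / i!, for m in Z. *)
Definition zbinom (K : numFieldType) (m : int) (i : nat) : K :=
  (\prod_(j < i) (m%:~R - j%:R)) / (i`!)%:R.

(** A family of modes [Y u n] (the coefficient u_n of x^(-n-1) in Y(u, x))
    which is a linear map from V (x) V to V((x)). *)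
Record is_mode_map (K : numFieldType) (V : lmodType K)
    (Y : V -> int -> V -> V) : Prop := IsModeMap {
  mode_linear_r : forall u n, linear (Y u n);
  mode_linear_l : forall n v, linear (fun u => Y u n v);
  mode_truncation : forall u v, exists N : int, forall n, N <= n -> Y u n v = 0
}.

(** The coefficient of x0^(-l-1) x1^(-m-1) x2^(-n-1) in
      x0^-1 delta((x1 - x2)/x0) A(u,x1) B(v,x2) w
        - x0^-1 delta((-x2 + x1)/x0) A(v,x2) B(u,x1) w
    is the sum over all i >= 0 of the terms below (almost all of them vanish);
    [jacobi_lhs] is the sum of the first [N] terms. *)
Definition jacobi_lhs (K : numFieldType) (V : lmodType K)
    (A B : V -> int -> V -> V) (u v w : V) (l m n : int) (N : nat) : V :=
  \sum_(i < N) ((-1) ^+ i * zbinom K l i) *: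
    (A u (m + l - i%:Z) (B v (n + i%:Z) w)
     - (-1) ^ l *: A v (n + l - i%:Z) (B u (m + i%:Z) w)).

(** Likewise for the same coefficient in x2^-1 delta((x1 - x0)/x2)
    A(B(u,x0)v,x2) w, since (-1)^i binom(i-m-1, i) = binom(m, i). *)
Definition jacobi_rhs (K : numFieldType) (V : lmodType K)
    (A B : V -> int -> V -> V) (u v w : V) (l m n : int) (N : nat) : V :=
  \sum_(i < N) zbinom K m i *: A (B u (l + i%:Z) v) (m + n - i%:Z) w.

(** Equality of two sums of infinite families with finite support, given by
    their partial sums. *)
Definition eventually_eq (V : Type) (f g : nat -> V) : Prop :=
  exists N0 : nat, forall N : nat, (N0 <= N)%N -> f N = g N.

Structure vertexAlgebra (K : numFieldType) := VertexAlgebra {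
  va_carrier :> lmodType K;
  va_mode : va_carrier -> int -> va_carrier -> va_carrier;
  va_vac : va_carrier;
  va_wt : int -> va_carrier -> Prop;
  va_mode_map : is_mode_map va_mode;
  va_grading : is_grading va_wt;
  va_wt_finite_dim : forall n, is_finite_dim (va_wt n);
  va_wt_bounded_below :
    exists N : int, forall n v, n < N -> va_wt n v -> v = 0;
  va_vac_wt : va_wt 0 va_vac;
  va_mode_wt : forall (p q n : int) u v, va_wt p u -> va_wt q v ->
    va_wt (p - n - 1 + q) (va_mode u n v);
  va_vacuum : forall n v,
    va_mode va_vac n v = if n == -1 then v else 0;
  va_creation : forall v, va_mode v (-1) va_vac = v;
  va_creation_regular : forall n v, 0 <= n -> va_mode v n va_vac = 0;
  va_D_bracket : forall u n v,
    va_mode (va_mode u n v) (-2) va_vac - va_mode u n (va_mode v (-2) va_vac)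
    = va_mode (va_mode u (-2) va_vac) n v;
  va_D_derivative : forall u n v,
    va_mode (va_mode u (-2) va_vac) n v = - n%:~R *: va_mode u (n - 1) v;
  va_jacobi : forall u v w l m n,
    eventually_eq (jacobi_lhs va_mode va_mode u v w l m n)
                  (jacobi_rhs va_mode va_mode u v w l m n)
}.

Definition va_D (K : numFieldType) (V : vertexAlgebra K) (v : V) : V :=
  va_mode v (-2) (va_vac V).

Record is_va_morphism (K : numFieldType) (U V : vertexAlgebra K) (f : U -> V) :
    Prop := IsVaMorphism {
  va_morphism_linear : linear f;
  va_morphism_vac : f (va_vac U) = va_vac V;
  va_morphism_mode : forall u n v, f (va_mode u n v) = va_mode (f u) n (f v);
  va_morphism_wt : forall n u, va_wt n u -> va_wt n (f u)
}.

Record is_graded_ideal (K : numFieldType) (V : vertexAlgebra K)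
    (I : V -> Prop) : Prop := IsGradedIdeal {
  ideal_subspace : is_subspace I;
  ideal_left : forall u n v, I v -> I (va_mode u n v);
  ideal_right : forall u n v, I v -> I (va_mode v n u);
  ideal_graded : forall v, I v -> exists (s : seq int) (f : int -> V),
    (forall n, va_wt n (f n) /\ I (f n)) /\ v = \sum_(n <- s) f n
}.

Definition is_max_proper_graded_ideal (K : numFieldType) (V : vertexAlgebra K)
    (I : V -> Prop) : Prop :=
  [/\ is_graded_ideal I,
      exists v, ~ I v &
      forall J : V -> Prop, is_graded_ideal J -> (exists v, ~ J v) ->
        forall v, J v -> I v].

(** * Affine vertex algebras *)

(** A module over the affine Lie algebra of g on which the central element acts
    by k; [act a n] is the action of a(n) = a (x) t^n. *)
Record is_affine_module (K : numFieldType) (g : vectType K)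
    (br : g -> g -> g) (form : g -> g -> K) (k : K) (W : lmodType K)
    (act : g -> int -> W -> W) : Prop := IsAffineModule {
  affine_linear_r : forall a n, linear (act a n);
  affine_linear_l : forall n w, linear (fun a => act a n w);
  affine_comm : forall a b m n w,
    act a m (act b n w) - act b n (act a m w) =
    act (br a b) (m + n) w +
    (if m + n == 0 then (m%:~R * form a b * k) *: w else 0)
}.

(** [a_1(-n_1) ... a_r(-n_r) 1] for [s = [:: (a_1, n_1); ...; (a_r, n_r)]]. *)
Definition affine_word (K : numFieldType) (g : vectType K)
    (V : vertexAlgebra K) (iota : g -> V) (s : seq (g * nat)) : V :=
  foldr (fun p w => va_mode (iota p.1) (- p.2%:Z) w) (va_vac V) s.

(** U is the universal affine vertex algebra of level k, with
    [iota a = a(-1) 1]: as a module over the affine Lie algebra it is the module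
    induced from the one-dimensional module on which a(n), n >= 0, acts by 0 and
    the central element by k. The homomorphism in [universal_affine_induced] is
    unique because of [universal_affine_span]. *)
Record is_universal_affine (K : numFieldType) (g : vectType K)
    (br : g -> g -> g) (form : g -> g -> K) (k : K)
    (U : vertexAlgebra K) (iota : g -> U) : Prop := IsUniversalAffine {
  universal_affine_linear : linear iota;
  universal_affine_module :
    is_affine_module br form k (fun a n => va_mode (iota a) n);
  universal_affine_vac : forall a n, 0 <= n ->
    va_mode (iota a) n (va_vac U) = 0;
  universal_affine_span : forall (d : int) (u : U), va_wt d u <->
    in_span (fun w => exists s : seq (g * nat),
      [/\ all (fun p => 0 < p.2)%N s, d = (\sum_(p <- s) p.2)%N%:Z
        & w = affine_word iota s]) u;
  universal_affine_induced :
    forall (W : lmodType K) (act : g -> int -> W -> W) (w0 : W),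
    is_affine_module br form k act ->
    (forall a n, 0 <= n -> act a n w0 = 0) ->
    exists f : U -> W, [/\ linear f, f (va_vac U) = w0 &
      forall a n u, f (va_mode (iota a) n u) = act a n (f u)]
}.

(** V is the quotient of the universal affine vertex algebra of level k by its
    maximal proper graded ideal, and [iota a] is the image of a(-1) 1. *)
Definition is_simple_affine (K : numFieldType) (g : vectType K)
    (br : g -> g -> g) (form : g -> g -> K) (k : K)
    (V : vertexAlgebra K) (iota : g -> V) : Prop :=
  exists (U : vertexAlgebra K) (iotaU : g -> U) (pi : U -> V),
    [/\ is_universal_affine br form k iotaU,
        is_va_morphism pi,
        (forall v, exists u, pi u = v),
        is_max_proper_graded_ideal (fun u => pi u = 0)
      & forall a, iota a = pi (iotaU a)].

(** * First-order deformations *)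

Record is_first_order_deformation (K : numFieldType) (V : vertexAlgebra K)
    (Y1 : V -> int -> V -> V) : Prop := IsFirstOrderDeformation {
  deformation_mode_map : is_mode_map Y1;
  deformation_wt : forall (p q n : int) u v, va_wt p u -> va_wt q v ->
    va_wt (p - n - 1 + q) (Y1 u n v);
  deformation_vacuum : forall n v, Y1 (va_vac V) n v = 0;
  deformation_creation : forall n v, Y1 v n (va_vac V) = 0;
  deformation_D_bracket : forall u n v,
    va_D (Y1 u n v) - Y1 u n (va_D v) = Y1 (va_D u) n v;
  deformation_D_derivative : forall u n v,
    Y1 (va_D u) n v = - n%:~R *: Y1 u (n - 1) v;
  deformation_jacobi : forall u v w l m n,
    eventually_eq
      (fun N => jacobi_lhs Y1 (@va_mode K V) u v w l m n N
                + jacobi_lhs (@va_mode K V) Y1 u v w l m n N)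
      (fun N => jacobi_rhs Y1 (@va_mode K V) u v w l m n N
                + jacobi_rhs (@va_mode K V) Y1 u v w l m n N)
}.

Definition is_trivial_deformation (K : numFieldType) (V : vertexAlgebra K)
    (Y1 : V -> int -> V -> V) : Prop :=
  exists phi : V -> V,
    [/\ linear phi,
        forall n v, va_wt n v -> va_wt n (phi v),
        phi (va_vac V) = 0
      & forall u n v,
          Y1 u n v = va_mode (phi u) n v - phi (va_mode u n v)
                     + va_mode u n (phi v)].

(* Main.v *)
(** A deformation which is regular on generators leaves the commutators of the
    modes of [a(-1) 1] undeformed, so [V + tV] is a module over the affine Lie
    algebra at level [k] and the universal affine vertex algebra [U] maps to it
    by some [pi + t psi]. The image under [psi] of the kernel of [pi] is a graded
    ideal of [V] without vacuum component, because the weight-zero part of [U]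
    is spanned by the vacuum; it vanishes by simplicity of [V]. Hence [psi]
    descends to [phi] on [V], and by the iterate formula the set of [u] at which
    [Y1] is the coboundary of [- phi] is closed under all modes; it contains the
    generators. *)

Require Import Defs.
From mathcomp Require Import all_boot all_order all_algebra.
From mathcomp Require Import complex reals.
From mathcomp Require Import zify.
Import GRing.Theory Num.Theory.
Local Open Scope ring_scope.
Local Open Scope complex_scope.

Set Implicit Arguments.
Unset Strict Implicit.

(** * Linear maps and subspaces given by predicates *)

Section LinearPredicate.
Context (K : numFieldType) (V W : lmodType K) (f : V -> W) (hf : linear f).

Lemma lin0 : f 0 = 0.
Proof. by have := hf (-1) 0 0; rewrite scaler0 addr0 scaleN1r addNr. Qed.

Lemma linZ a u : f (a *: u) = a *: f u.
Proof. by rewrite -[a *: u]addr0 hf lin0 addr0. Qed.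

Lemma linD u v : f (u + v) = f u + f v.
Proof. by rewrite -[u in LHS]scale1r hf scale1r. Qed.

Lemma linB u v : f (u - v) = f u - f v.
Proof. by rewrite linD -scaleN1r linZ scaleN1r. Qed.

Lemma lin_sum (I : Type) (r : seq I) (P : pred I) (F : I -> V) :
  f (\sum_(i <- r | P i) F i) = \sum_(i <- r | P i) f (F i).
Proof. by apply: (big_morph f linD lin0). Qed.

Lemma is_subspace_preim (S : W -> Prop) :
  is_subspace S -> is_subspace (fun v => S (f v)).
Proof.
move=> [S0 SD]; split; first by rewrite lin0.
by move=> a u v Su Sv; rewrite hf; apply: SD.
Qed.

Lemma is_subspace_im (S : V -> Prop) :
  is_subspace S -> is_subspace (fun w => exists2 v, S v & f v = w).
Proof.
move=> [S0 SD]; split; first by exists 0; rewrite ?lin0.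
move=> a _ _ [u Su <-] [v Sv <-]; exists (a *: u + v); last exact: hf.
exact: SD.
Qed.

End LinearPredicate.

Section Subspace.
Context (K : numFieldType) (V : lmodType K) (S : V -> Prop).
Context (hS : is_subspace S).

Lemma subspaceZ a u : S u -> S (a *: u).
Proof. by move=> Su; rewrite -[_ *: _]addr0; apply: hS.2 => //; exact: hS.1. Qed.

Lemma subspaceD u v : S u -> S v -> S (u + v).
Proof. by move=> Su Sv; rewrite -[u]scale1r; apply: hS.2. Qed.

Lemma subspaceB u v : S u -> S v -> S (u - v).
Proof.
by move=> Su Sv; apply: subspaceD => //; rewrite -scaleN1r; apply: subspaceZ.
Qed.

Lemma subspace_sum (I : Type) (r : seq I) (P : pred I) (F : I -> V) :
  (forall i, P i -> S (F i)) -> S (\sum_(i <- r | P i) F i).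
Proof.
move=> SF; apply: (big_ind S) => //; first exact: hS.1.
exact: subspaceD.
Qed.

Lemma subspace_span (T : V -> Prop) v :
  (forall w, T w -> S w) -> in_span T v -> S v.
Proof.
move=> TS [d [e [c [Te ->]]]]; apply: subspace_sum => i _.
by apply: subspaceZ; apply: TS.
Qed.

End Subspace.

(** * Homogeneous components in a graded space *)

Lemma sum_fibers (T : eqType) (V : zmodType) (t s : seq T) (f : T -> V) :
  uniq t -> {subset s <= t} ->
  \sum_(n <- t) \sum_(m <- s | m == n) f m = \sum_(m <- s) f m.
Proof.
move=> t_uniq st; rewrite (exchange_big_dep xpredT) //=.
rewrite big_seq [RHS]big_seq; apply: eq_bigr => m /st mt.
rewrite (eq_bigl (pred1 m)) => [|n]; last exact: eq_sym.
by rewrite -big_filter filter_pred1_uniq // big_seq1.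
Qed.

Section Grading.
Context (K : numFieldType) (V : lmodType K) (G : int -> V -> Prop).
Context (hG : is_grading G).

Lemma grading_fiber (s : seq int) (f : int -> V) n :
  (forall m, G m (f m)) -> G n (\sum_(m <- s | m == n) f m).
Proof.
by move=> Gf; apply: (subspace_sum (grading_subspace hG n)) => m /eqP <-.
Qed.

Lemma grading_component (s s' : seq int) (f f' : int -> V) n :
    (forall m, G m (f m)) -> (forall m, G m (f' m)) ->
    \sum_(m <- s) f m = \sum_(m <- s') f' m ->
  \sum_(m <- s | m == n) f m = \sum_(m <- s' | m == n) f' m.
Proof.
move=> Gf Gf' eq_sum; apply/subr0_eq.
(* Decompositions may repeat indices, so a component is a sum over a fiber, and directness needs a
   duplicate-free list. It includes [n], which may occur in neither [s] nor [s']. *)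
pose t := undup (n :: s ++ s').
pose h m := \sum_(p <- s | p == m) f p - \sum_(p <- s' | p == m) f' p.
apply: (grading_direct hG (s := t) (f := h)).
- exact: undup_uniq.
- by move=> m; apply: (subspaceB (grading_subspace hG m)); apply: grading_fiber.
- rewrite sumrB !sum_fibers ?undup_uniq ?eq_sum ?subrr //.
  + by move=> x xs; rewrite mem_undup inE mem_cat xs !orbT.
  + by move=> x xs; rewrite mem_undup inE mem_cat xs !orbT.
- by rewrite mem_undup mem_head.
Qed.

Lemma grading_component_homog (s : seq int) (f : int -> V) n x :
    (forall m, G m (f m)) -> G n x -> \sum_(m <- s) f m = x ->
  \sum_(m <- s | m == n) f m = x.
Proof.
move=> Gf Gx eq_sum; pose f' m := if m == n then x else 0.
rewrite (grading_component (s' := [:: n]) (f' := f')) //.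
- by rewrite big_mkcond big_seq1 /f' eqxx.
- rewrite /f' => m; case: eqP => [->|_] //.
  by case: (grading_subspace hG m).
- by rewrite big_seq1 /f' eqxx.
Qed.

End Grading.

(** * Specializations of the Jacobi identity: [l = 0] for commutators, [m = 0] for iterates *)

Lemma zbinom_r0 (K : numFieldType) m : zbinom K m 0 = 1.
Proof. by rewrite /zbinom big_ord0 fact0 divr1. Qed.

Lemma zbinom_0S (K : numFieldType) i : zbinom K 0 i.+1 = 0.
Proof. by rewrite /zbinom big_ord_recl subrr !mul0r. Qed.

Section JacobiSums.
Context (K : numFieldType) (V : lmodType K) (A B : V -> int -> V -> V).

Lemma jacobi_lhs_l0 u v w m n N : (0 < N)%N ->
  jacobi_lhs A B u v w 0 m n N = A u m (B v n w) - A v n (B u m w).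
Proof.
case: N => // N _; rewrite /jacobi_lhs big_ord_recl big1 => [|i _].
  by rewrite zbinom_r0 mulr1 scale1r !addr0 ?subr0 expr0z scale1r.
by rewrite zbinom_0S mulr0 scale0r.
Qed.

Lemma jacobi_rhs_m0 u v w l n N : (0 < N)%N ->
  jacobi_rhs A B u v w l 0 n N = A (B u l v) n w.
Proof.
case: N => // N _; rewrite /jacobi_rhs big_ord_recl big1 => [|i _].
  by rewrite zbinom_r0 scale1r !addr0 add0r ?subr0.
by rewrite zbinom_0S scale0r.
Qed.

End JacobiSums.

(** * Closure of subspaces under modes, from the iterate formula and skew-symmetry *)

Section VertexAlgebra.
Context (K : numFieldType) (V : vertexAlgebra K).
Implicit Types (u v w x : V) (S P : V -> Prop).

Lemma va_mode_lin_r u n : linear (va_mode u n).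
Proof. exact: mode_linear_r (va_mode_map V) u n. Qed.

Lemma va_mode_lin_l n v : linear (fun u => va_mode u n v).
Proof. exact: mode_linear_l (va_mode_map V) n v. Qed.

Lemma va_iterate u v w l n : exists N0, forall N, (N0 <= N)%N ->
  va_mode (va_mode u l v) n w = jacobi_lhs (@va_mode K V) (@va_mode K V) u v w l 0 n N.
Proof.
have [N0 hN] := va_jacobi u v w l 0 n; exists N0.+1 => N le_N.
by rewrite hN 1?ltnW // jacobi_rhs_m0 // (leq_trans _ le_N).
Qed.

(** The Jacobi identity on the vacuum at [m = -1], [n = 0]. *)
Lemma va_skew_symmetry u v l : exists N, - (-1) ^ l *: va_mode v l u =
  \sum_(i < N) zbinom K (-1) i *:
    va_mode (va_mode u (l + i%:Z) v) (- (i.+1)%:Z) (va_vac V).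
Proof.
have [N0 hN] := va_jacobi u v (va_vac V) l (-1) 0; exists N0.+1.
have := hN _ (leqnSn N0); rewrite /jacobi_lhs big_ord_recl big1 => [|i _].
  rewrite zbinom_r0 mulr1 scale1r !addr0 va_creation_regular //.
  rewrite (lin0 (va_mode_lin_r _ _)) sub0r ?add0r ?subr0 va_creation.
  rewrite -scaleNr => ->; rewrite /jacobi_rhs; apply: eq_bigr => i _.
  by congr (_ *: va_mode _ _ _); lia.
rewrite !va_creation_regular ?(lin0 (va_mode_lin_r _ _)) ?scaler0 ?subrr ?scaler0 //.
Qed.

(** The vector is [D^i x / i!]; each step of the induction divides by [i + 1], which is nonzero in
    characteristic 0. *)
Lemma va_mode_neg_vac S x i : is_subspace S -> (forall y, S y -> S (va_D y)) ->
  S x -> S (va_mode x (- (i.+1)%:Z) (va_vac V)).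
Proof.
move=> hS SD; elim: i x => [|i IHi] x Sx; first by rewrite va_creation.
have := IHi _ (SD _ Sx); rewrite /va_D va_D_derivative.
rewrite mulrNz opprK -opprD -PoszD addn1 => /(subspaceZ hS (i.+1%:R^-1)).
by rewrite scalerA -pmulrn mulVf ?scale1r // pnatr_eq0.
Qed.

(** Skew-symmetry expands [v_l u] in the vectors [(u_(l+i) v)_(-i-1) 1]. This turns left ideals
    stable under [D] into two-sided ones. *)
Lemma va_mode_right S u v l : is_subspace S -> (forall y, S y -> S (va_D y)) ->
  (forall n, S (va_mode u n v)) -> S (va_mode v l u).
Proof.
move=> hS SD Suv; have [N eq_vu] := va_skew_symmetry u v l.
have c_neq0 : - (-1) ^ l != 0 :> K by rewrite oppr_eq0 expfz_neq0 // oppr_eq0 oner_eq0.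
rewrite -[va_mode v l u]scale1r -(mulVf c_neq0) -scalerA eq_vu.
apply: (subspaceZ hS); apply: (subspace_sum hS) => i _.
by apply: (subspaceZ hS); apply: va_mode_neg_vac.
Qed.

Lemma va_mode_iterate S u v w l n : is_subspace S ->
  (forall p q, S (va_mode u p (va_mode v q w))) ->
  (forall p q, S (va_mode v p (va_mode u q w))) ->
  S (va_mode (va_mode u l v) n w).
Proof.
move=> hS Suv Svu; have [N /(_ N (leqnn N)) ->] := va_iterate u v w l n.
apply: (subspace_sum hS) => i _; apply: (subspaceZ hS); apply: (subspaceB hS) => //.
exact: (subspaceZ hS).
Qed.

End VertexAlgebra.

(** * Universal affine vertex algebras and their simple quotients *)

Section Affine.
Context (K : numFieldType) (g : vectType K) (br : g -> g -> g).
Context (form : g -> g -> K) (k : K).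

Lemma universal_affine_ind (U : vertexAlgebra K) (iota : g -> U)
    (P : U -> Prop) : is_universal_affine br form k iota ->
  is_subspace P -> P (va_vac U) ->
  (forall a n u, P u -> P (va_mode (iota a) n u)) -> forall u, P u.
Proof.
move=> hU hP P1 PM u; have [s [f [Gf ->]]] := grading_sum (va_grading U) u.
apply: (subspace_sum hP) => n _; have /(universal_affine_span hU) := Gf n.
apply: (subspace_span hP) => w [t [_ _ ->]].
by elim: t => [|p t IHt] //=; exact: PM.
Qed.

(** Every letter of a spanning word has positive weight, so only the empty word has weight zero. *)
Lemma universal_affine_wt0 (U : vertexAlgebra K) (iota : g -> U) (u : U) :
  is_universal_affine br form k iota -> va_wt 0 u -> exists c, u = c *: va_vac U.
Proof.
move=> hU /(universal_affine_span hU).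
apply: (subspace_span (S := fun u => exists c, u = c *: va_vac U)).
  split; first by exists 0; rewrite scale0r.
  by move=> a _ _ [c ->] [d ->]; exists (a * c + d); rewrite scalerA scalerDl.
move=> w [[|[a n] s] [/= s_gt0 eq_s ->]]; first by exists 1; rewrite scale1r.
move: s_gt0 eq_s; rewrite big_cons /= => /andP[n_gt0 _] /eqP.
by rewrite eqz_nat eq_sym addn_eq0 eqn0Ngt n_gt0.
Qed.

Section Quotient.
Context (U V : vertexAlgebra K) (iotaU : g -> U) (iota : g -> V) (pi : U -> V).
Context (hU : is_universal_affine br form k iotaU) (hpi : is_va_morphism pi).
Context (pi_surj : forall v, exists u, pi u = v).
Context (hker : is_max_proper_graded_ideal (fun u => pi u = 0)).
Context (iotaE : forall a, iota a = pi (iotaU a)).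

Let pi_lin : linear pi := va_morphism_linear hpi.

Lemma quotient_mode a n u : pi (va_mode (iotaU a) n u) = va_mode (iota a) n (pi u).
Proof. by rewrite iotaE (va_morphism_mode hpi). Qed.

Lemma quotient_generated_ind (P : V -> Prop) : is_subspace P ->
    P (va_vac V) -> (forall a, P (iota a)) ->
    (forall u n v, P u -> P v -> P (va_mode u n v)) ->
  forall v, P v.
Proof.
move=> hP P1 Piota PM v; have [u <-] := pi_surj v.
apply: (universal_affine_ind (P := fun u => P (pi u)) hU).
- exact: (is_subspace_preim pi_lin hP).
- by rewrite (va_morphism_vac hpi).
- by move=> a n w Pw; rewrite quotient_mode; apply: PM.
Qed.

Lemma quotient_affine_module :
  is_affine_module br form k (fun a n => va_mode (iota a) n).
Proof.
have hM := universal_affine_module hU.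
split=> [a n|n v c a b|a b m n v]; first exact: va_mode_lin_r.
  rewrite !iotaE (universal_affine_linear hU) pi_lin.
  exact: va_mode_lin_l.
have [u <-] := pi_surj v.
rewrite -!quotient_mode -(linB pi_lin) (affine_comm hM) (linD pi_lin).
by case: ifP => _; rewrite ?(linZ pi_lin) ?(lin0 pi_lin).
Qed.

Lemma quotient_iota_wt a : va_wt 1 (iota a).
Proof.
rewrite iotaE; apply: (va_morphism_wt hpi); apply/(universal_affine_span hU).
exists 1%N, (fun=> iotaU a), (fun=> 1); split=> [_|]; last by rewrite big_ord1 scale1r.
exists [:: (a, 1%N)]; split=> //=; first by rewrite big_seq1.
by rewrite va_creation.
Qed.

(** The component of weight [n] of any preimage works, because [pi] preserves weights and the
    grading of [V] is direct. *)
Lemma quotient_wt_surj n v : va_wt n v -> exists2 u, va_wt n u & pi u = v.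
Proof.
move=> Vv; have [u eq_u] := pi_surj v.
have [s [f [Gf def_u]]] := grading_sum (va_grading U) u.
exists (\sum_(m <- s | m == n) f m); first exact: (grading_fiber (va_grading U)).
rewrite (lin_sum pi_lin); apply: (grading_component_homog (va_grading V)) => //.
  by move=> m; apply: (va_morphism_wt hpi).
by rewrite -(lin_sum pi_lin) -def_u.
Qed.

(** The preimage of [S] under [pi] is a graded ideal of [U] that misses the vacuum. It is therefore
    proper, and maximality puts it inside the kernel. *)
Lemma simple_affine_submodule0 (S : V -> Prop) :
    is_subspace S -> (forall a n v, S v -> S (va_mode (iota a) n v)) ->
    (forall v, S v -> S (va_D v)) ->
    (forall v, S v -> exists (s : seq int) (f : int -> V),
      (forall n, va_wt n (f n) /\ S (f n)) /\ v = \sum_(n <- s) f n) ->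
    ~ S (va_vac V) -> forall v, S v -> v = 0.
Proof.
move=> hS SM SD Sgr S1 v Sv.
(* The vectors [u] whose modes all preserve [S] include the generators and are closed under products
   by the iterate formula. *)
have Sleft u : forall n w, S w -> S (va_mode u n w).
  apply: (quotient_generated_ind (P := fun u => forall n w, S w -> S (va_mode u n w))) => //.
  - split=> [n w _|c u1 u2 S1u S2u n w Sw].
      by rewrite (lin0 (va_mode_lin_l n w)); exact: hS.1.
    by rewrite (va_mode_lin_l n w); apply: hS.2; auto.
  - move=> n w Sw; rewrite va_vacuum; case: ifP => // _; exact: hS.1.
  - by move=> u1 n u2 S1u S2u m w Sw; apply: va_mode_iterate => // *; auto.
have [u eq_u] := pi_surj v; rewrite -eq_u.
apply: (let: And3 _ _ max := hker in max (fun u => S (pi u))).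
- split.
  + exact: (is_subspace_preim pi_lin hS).
  + by move=> x n y Sy; rewrite (va_morphism_mode hpi); apply: Sleft.
  + move=> x n y Sy; rewrite (va_morphism_mode hpi).
    by apply: va_mode_right => // m; apply: Sleft.
  + move=> x /Sgr [s [f [hf eq_x]]].
    have [t [h [Gh def_x]]] := grading_sum (va_grading U) x.
    (* The decomposition has to come from [U]. Its components map into [S] because they match, by
       uniqueness in [V], those of the given decomposition of [pi x]. *)
    exists (undup t), (fun n => \sum_(m <- t | m == n) h m); split; last first.
      by rewrite sum_fibers ?undup_uniq // => y; rewrite mem_undup.
    move=> n; split; first exact: (grading_fiber (va_grading U)).
    rewrite (lin_sum pi_lin).
    rewrite (grading_component (va_grading V) (s' := s) (f' := f)) //.
    * by apply: (subspace_sum hS) => m _; case: (hf m).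
    * by move=> m; apply: (va_morphism_wt hpi).
    * by move=> m; case: (hf m).
    * by rewrite -(lin_sum pi_lin) -def_x.
- by exists (va_vac U); rewrite (va_morphism_vac hpi).
- by rewrite eq_u.
Qed.

End Quotient.
End Affine.

(** * Coboundaries and their closure under products *)

Section Leibniz.
Context (K : numFieldType) (V : vertexAlgebra K) (Y1 : V -> int -> V -> V).
Context (hY1 : is_first_order_deformation Y1).
Context (phi : V -> V) (phi_lin : linear phi) (phi1 : phi (va_vac V) = 0).

Let Y1_lin_r u n : linear (Y1 u n) := mode_linear_r (deformation_mode_map hY1) u n.
Let Y1_lin_l n v : linear (fun u => Y1 u n v) :=
  mode_linear_l (deformation_mode_map hY1) n v.

(** This is the coefficient of [t] in the condition that [id + t phi] carries [Y(u,x)v] to its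
    counterpart for [Y + t Y1]. *)
Definition coboundary_at (u : V) : Prop := forall n v,
  Y1 u n v = phi (va_mode u n v) - va_mode (phi u) n v - va_mode u n (phi v).

Lemma coboundary_at_subspace : is_subspace coboundary_at.
Proof.
split=> [n v|a u u' hu hu' n v].
  rewrite (lin0 (Y1_lin_l n v)) (lin0 phi_lin) !(lin0 (va_mode_lin_l n _)).
  by rewrite (lin0 phi_lin) !subr0.
rewrite (Y1_lin_l n v) hu hu' phi_lin !(va_mode_lin_l n _) phi_lin !scalerBr.
by rewrite !opprD [LHS]addrACA [X in X + _ = _]addrACA.
Qed.

Lemma coboundary_at_vac : coboundary_at (va_vac V).
Proof.
move=> n v; rewrite (deformation_vacuum hY1) phi1 (lin0 (va_mode_lin_l n v)).
by rewrite !va_vacuum subr0; case: ifP => _; rewrite ?(lin0 phi_lin) subrr.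
Qed.

(** Each product of two modes obeys a Leibniz rule with defect given by [Y1]; the rule passes to the
    linear combination in the Jacobi sum. *)
Lemma jacobi_lhs_leibniz u v w l n N : coboundary_at u -> coboundary_at v ->
  let J := jacobi_lhs (@va_mode K V) (@va_mode K V) in
  jacobi_lhs Y1 (@va_mode K V) u v w l 0 n N
    + jacobi_lhs (@va_mode K V) Y1 u v w l 0 n N
  = phi (J u v w l 0 n N) - J (phi u) v w l 0 n N - J u (phi v) w l 0 n N
    - J u v (phi w) l 0 n N.
Proof.
move=> hu hv J; rewrite {}/J /jacobi_lhs (lin_sum phi_lin).
rewrite -big_split -!sumrB; apply: eq_bigr => i _.
set c := _ * _; rewrite /= (linZ phi_lin) -scalerDr -!scalerBr; congr (_ *: _).
(* Here [y] is the mixed term [x_p (phi (x'_q w))], which the two summands contribute with opposite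
   signs. *)
have merge x1 x2 x3 x4 y : x1 - x2 - y + (y - x3 - x4) = x1 - x2 - x3 - x4 :> V.
  by rewrite addrA addrA subrK.
have hT x x' p q : coboundary_at x -> coboundary_at x' ->
    Y1 x p (va_mode x' q w) + va_mode x p (Y1 x' q w) =
    phi (va_mode x p (va_mode x' q w)) - va_mode (phi x) p (va_mode x' q w)
    - va_mode x p (va_mode (phi x') q w) - va_mode x p (va_mode x' q (phi w)).
  by move=> hx hx'; rewrite hx hx' !(linB (va_mode_lin_r x p)) merge.
rewrite addrACA -opprD -scalerDr !hT //.
rewrite (linB phi_lin) (linZ phi_lin) !scalerBr.
set a := _ ^ l.
have addBACA (x y x' y' : V) : (x - y) - (x' - y') = (x - x') - (y - y').
  by rewrite !opprB addrACA [RHS]addrACA [- y + _]addrC.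
rewrite addBACA; congr (_ - _); rewrite [X in _ - X = _]addrAC addBACA; congr (_ - _).
exact: addBACA.
Qed.

(** At [m = 0] the right side of the deformed Jacobi identity is [Y1 (u_l v) n w + (Y1 u l v)_n w].
    The left side is given by the Leibniz rule, and the second term on the right by the hypothesis
    on [u]. *)
Lemma coboundary_at_mode u l v :
  coboundary_at u -> coboundary_at v -> coboundary_at (va_mode u l v).
Proof.
move=> hu hv n w.
have [N0 hN0] := deformation_jacobi hY1 u v w l 0 n.
have [N1 hN1] := va_iterate u v w l n.
have [N2 hN2] := va_iterate (phi u) v w l n.
have [N3 hN3] := va_iterate u (phi v) w l n.
have [N4 hN4] := va_iterate u v (phi w) l n.
(* One [N] must exceed all five stabilization bounds, and be positive so that the right sums contain
   their term [i = 0]. *)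
have [N [N_gt0 le0 le1 le2 [le3 le4]]] : exists N,
    [/\ 0 < N, N0 <= N, N1 <= N, N2 <= N & N3 <= N /\ N4 <= N]%N.
  by exists (N0 + N1 + N2 + N3 + N4).+1; split; lia.
have := hN0 N le0.
rewrite jacobi_lhs_leibniz // !jacobi_rhs_m0 //.
rewrite -hN1 // -hN2 // -hN3 // -hN4 // => /esym eqY.
apply: (addIr (va_mode (Y1 u l v) n w)); rewrite eqY hu !(linB (va_mode_lin_l n w)).
rewrite [X in _ = X + _]addrAC [RHS]addrA addrA subrK.
by rewrite [LHS]addrAC [X in X - _ = _]addrAC.
Qed.

End Leibniz.

(** * The deformed action of the affine Lie algebra on [V + tV] *)

Section Deformation.
Context (K : numFieldType) (g : vectType K) (br : g -> g -> g).
Context (form : g -> g -> K) (k : K).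
Context (V : vertexAlgebra K) (iota : g -> V) (Y1 : V -> int -> V -> V).
Context (hV : is_affine_module br form k (fun a n => va_mode (iota a) n)).
Context (hY1 : is_first_order_deformation Y1).
Context (hreg : forall a b n, 0 <= n -> Y1 (iota a) n (iota b) = 0).

Lemma affine_iota_lin : linear iota.
Proof.
move=> c a b; have := affine_linear_l hV (-1) (va_vac V) c a b.
by rewrite !va_creation.
Qed.

(** Apply the affine commutator with [n = -1] to the vacuum, which [a(i)] kills. *)
Lemma affine_iota_mode a b (i : nat) : va_mode (iota a) i (iota b) =
  if i is j.+1 then (if j is 0 then (form a b * k) *: va_vac V else 0)
  else iota (br a b).
Proof.
have := affine_comm hV a b i (-1) (va_vac V).
rewrite va_creation va_creation_regular // (lin0 (va_mode_lin_r _ _)) subr0 => ->.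
case: i => [|[|i]].
- by rewrite add0r va_creation addr0.
- by rewrite subrr eqxx mul1r va_creation_regular // add0r.
rewrite va_creation_regular; last by lia.
by case: eqP => [/eqP|_]; [lia | rewrite addr0].
Qed.

(** In the commutator formula regularity kills the terms with [Y1 (iota a) i (iota b)]. Among the
    undeformed products only the bracket survives, since [Y1] vanishes on the vacuum; hence the
    level gets no correction. *)
Lemma deformed_comm a b m n v :
  Y1 (iota a) m (va_mode (iota b) n v) + va_mode (iota a) m (Y1 (iota b) n v)
  - (Y1 (iota b) n (va_mode (iota a) m v) + va_mode (iota b) n (Y1 (iota a) m v))
  = Y1 (iota (br a b)) (m + n) v.
Proof.
have [N0 /(_ N0.+2)] := deformation_jacobi hY1 (iota a) (iota b) v 0 m n.
rewrite -addn2 leq_addr !jacobi_lhs_l0 ?addn2 // => /(_ isT).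
rewrite opprD addrACA => ->.
rewrite /jacobi_rhs [X in _ + X]big1 => [|i _]; last first.
  by rewrite hreg ?add0r // (lin0 (va_mode_lin_l _ _)) scaler0.
rewrite addr0 big_ord_recl big1 => [|i _].
  by rewrite zbinom_r0 scale1r add0r (affine_iota_mode a b 0) subr0 addr0.
rewrite add0r affine_iota_mode /=.
have Y1l p w := mode_linear_l (deformation_mode_map hY1) p w.
case: (nat_of_ord i) => [|j]; last by rewrite (lin0 (Y1l _ _)) scaler0.
by rewrite (linZ (Y1l _ _)) (deformation_vacuum hY1) !scaler0.
Qed.

(** Pairs [(v, w)] stand for [v + t w], modulo [t^2]. *)
Definition deformed_act a n (p : V * V) : V * V :=
  (va_mode (iota a) n p.1, va_mode (iota a) n p.2 + Y1 (iota a) n p.1).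

(** The first coordinate is the action on [V]; the [t] coefficient of the commutator is that action
    plus the correction from [deformed_comm]. *)
Lemma deformed_affine_module : is_affine_module br form k deformed_act.
Proof.
have Y1l p w := mode_linear_l (deformation_mode_map hY1) p w.
have Y1r u p := mode_linear_r (deformation_mode_map hY1) u p.
split=> [a n c p q|n p c a b|a b m n p]; rewrite /deformed_act.
- congr (_, _); rewrite /= ?va_mode_lin_r // Y1r scalerDr.
  by rewrite addrACA.
- rewrite affine_iota_lin; congr (_, _); rewrite /= ?va_mode_lin_l // Y1l scalerDr.
  by rewrite addrACA.
- have eq2 : va_mode (iota a) m (va_mode (iota b) n p.2 + Y1 (iota b) n p.1)
        + Y1 (iota a) m (va_mode (iota b) n p.1)
      - (va_mode (iota b) n (va_mode (iota a) m p.2 + Y1 (iota a) m p.1)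
        + Y1 (iota b) n (va_mode (iota a) m p.1))
      = va_mode (iota a) m (va_mode (iota b) n p.2)
        - va_mode (iota b) n (va_mode (iota a) m p.2)
        + Y1 (iota (br a b)) (m + n) p.1.
    rewrite -deformed_comm !(linD (va_mode_lin_r _ _)).
    rewrite -[X in X - _ = _]addrA -[X in _ - X = _]addrA opprD addrACA.
    by congr (_ + (_ - _)); rewrite addrC.
  have := affine_comm hV a b m n; case: (m + n == 0) => comm.
  + by congr (_, _); rewrite /= ?eq2 comm // addrAC.
  + by congr (_, _); rewrite /= ?eq2 comm // !addr0.
Qed.

End Deformation.

(** * Lifting to the universal algebra and descending to [V] *)

Section AffineDeformation.
Context (K : numFieldType) (g : vectType K) (br : g -> g -> g).
Context (form : g -> g -> K) (k : K).
Context (U V : vertexAlgebra K) (iotaU : g -> U) (iota : g -> V) (pi : U -> V).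
Context (hU : is_universal_affine br form k iotaU) (hpi : is_va_morphism pi).
Context (pi_surj : forall v, exists u, pi u = v).
Context (hker : is_max_proper_graded_ideal (fun u => pi u = 0)).
Context (iotaE : forall a, iota a = pi (iotaU a)).
Context (Y1 : V -> int -> V -> V) (hY1 : is_first_order_deformation Y1).
Context (hreg : forall a b n, 0 <= n -> Y1 (iota a) n (iota b) = 0).

Let pi_lin : linear pi := va_morphism_linear hpi.
Let Y1_lin_r u n : linear (Y1 u n) := mode_linear_r (deformation_mode_map hY1) u n.
Let pi_mode := quotient_mode hpi iotaE.

(** An ideal containing the vacuum contains every [u = u_(-1) 1]. *)
Lemma vac_notin_ker : pi (va_vac U) <> 0.
Proof.
case: hker => ideal [u u_nker] _ vac0; apply: u_nker.
by rewrite -[u]va_creation; exact: (ideal_left ideal).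
Qed.

(** The universal property, applied with the vector [(1, 0)], gives a map to pairs. Its first
    coordinate agrees with [pi] by induction on generators, and [psi] is the second. *)
Lemma deformed_lift : exists psi : U -> V,
  [/\ linear psi, psi (va_vac U) = 0 & forall a n u,
    psi (va_mode (iotaU a) n u)
    = va_mode (iota a) n (psi u) + Y1 (iota a) n (pi u)].
Proof.
have hV := quotient_affine_module hU hpi pi_surj iotaE.
have hW := deformed_affine_module hV hY1 hreg.
have [|f [f_lin f1 fM]] := universal_affine_induced hU (w0 := (va_vac V, 0)) hW.
  move=> a n n_ge0; rewrite /deformed_act /= va_creation_regular //.
  by rewrite (deformation_creation hY1) (lin0 (va_mode_lin_r _ _)) addr0.
have f_pi u : (f u).1 = pi u.
  apply/subr0_eq; move: u; apply: (universal_affine_ind hU).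
  - split=> [|a u v]; first by rewrite (lin0 f_lin) (lin0 pi_lin) subr0.
    by rewrite f_lin pi_lin /= opprD addrACA -scalerBr => -> ->; rewrite scaler0 addr0.
  - by rewrite f1 (va_morphism_vac hpi) subrr.
  - by move=> a n u /subr0_eq eq_u; rewrite fM pi_mode /= eq_u subrr.
exists (fun u => (f u).2); split=> [a u v||a n u]; first by rewrite f_lin.
- by rewrite f1.
- by rewrite fM /= f_pi.
Qed.

Section Lift.
Context (psi : U -> V) (psi_lin : linear psi) (psi1 : psi (va_vac U) = 0).
Context (psiM : forall a n u, psi (va_mode (iotaU a) n u)
  = va_mode (iota a) n (psi u) + Y1 (iota a) n (pi u)).

Lemma lift_wt n u : va_wt n u -> va_wt n (psi u).
Proof.
move=> /(universal_affine_span hU).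
apply: (subspace_span (S := fun w => va_wt n (psi w))).
  exact: (is_subspace_preim psi_lin (grading_subspace (va_grading V) n)).
move=> _ [s [_ -> ->]].
(* The weight of [pi] is carried along because the recursion for [psi] involves [pi] of the tail. *)
suff [] : va_wt (\sum_(p <- s) p.2)%N%:Z (psi (affine_word iotaU s))
       /\ va_wt (\sum_(p <- s) p.2)%N%:Z (pi (affine_word iotaU s)) by [].
elim: s => [|[a m] s [IHpsi IHpi]] /=.
  rewrite big_nil psi1 (va_morphism_vac hpi); split; last exact: va_vac_wt.
  by case: (grading_subspace (va_grading V) 0).
have iota_wt := quotient_iota_wt hU hpi iotaE a.
rewrite big_cons /= psiM pi_mode.
have -> : (m + \sum_(p <- s) p.2)%N%:Z = 1 - - m%:Z - 1 + (\sum_(p <- s) p.2)%N%:Z by lia.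
split; last exact: va_mode_wt.
apply: (subspaceD (grading_subspace (va_grading V) _)); first exact: va_mode_wt.
exact: (deformation_wt hY1).
Qed.

(** The modes of [Y] and of [Y1] have the same commutation rule with [D], so the recursion for [psi]
    propagates the identity from the vacuum. *)
Lemma lift_D u : psi (va_D u) = va_D (psi u).
Proof.
apply/subr0_eq; move: u; apply: (universal_affine_ind hU).
- have D_lin (W : vertexAlgebra K) : linear (@va_D K W) by exact: va_mode_lin_l.
  split=> [|a u v]; first by rewrite !(lin0 (D_lin _), lin0 psi_lin) subr0.
  by rewrite !(D_lin _, psi_lin) opprD addrACA -scalerBr => -> ->; rewrite scaler0 addr0.
- by rewrite /va_D va_vacuum psi1 (lin0 (va_mode_lin_l _ _)) (lin0 psi_lin) subrr.
- have D_mode (W : vertexAlgebra K) (x y : W) n :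
      va_D (va_mode x n y) = va_mode x n (va_D y) - n%:~R *: va_mode x (n - 1) y.
    by rewrite -scaleNr -va_D_derivative -va_D_bracket addrC subrK.
  have D_Y1 (x y : V) n : va_D (Y1 x n y) = Y1 x n (va_D y) - n%:~R *: Y1 x (n - 1) y.
    rewrite -scaleNr -(deformation_D_derivative hY1) -(deformation_D_bracket hY1).
    by rewrite addrC subrK.
  have pi_D u : pi (va_D u) = va_D (pi u).
    by rewrite /va_D (va_morphism_mode hpi) (va_morphism_vac hpi).
  move=> a n u /subr0_eq eq_u; apply/eqP; rewrite subr_eq0; apply/eqP.
  rewrite D_mode (linB psi_lin) (linZ psi_lin) !psiM pi_D eq_u.
  rewrite /va_D (linD (va_mode_lin_l _ _)) -!/(va_D _) D_mode D_Y1.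
  by rewrite scalerDr opprD addrACA.
Qed.

Lemma lift_ker u : pi u = 0 -> psi u = 0.
Proof.
have [ideal _ _] := hker; have vac_nker := vac_notin_ker.
pose S v := exists2 y, pi y = 0 & psi y = v.
move=> pi_u0; apply: (simple_affine_submodule0 hU hpi pi_surj hker iotaE (S := S)).
- exact: is_subspace_im psi_lin _ (ideal_subspace ideal).
- move=> a n _ [y y0 <-]; exists (va_mode (iotaU a) n y).
    exact: (ideal_left ideal).
  by rewrite psiM y0 (lin0 (Y1_lin_r _ _)) addr0.
- move=> _ [y y0 <-]; exists (va_D y); last exact: lift_D.
  exact: (ideal_right ideal).
- move=> _ [y y0 <-]; have [s [f [hf ->]]] := ideal_graded ideal y0.
  exists s, (psi \o f); split; last by rewrite (lin_sum psi_lin).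
  move=> n; have [Gf f0] := hf n; split; first exact: lift_wt.
  by exists (f n).
(* If [psi y] were the vacuum, so would be [psi z] for the weight-zero part [z] of [y]. But [z] is a
   multiple of the vacuum of [U], which [psi] kills, so the vacuum of [V] would be 0. *)
- case=> y y0 psi_y; have [s [f [hf def_y]]] := ideal_graded ideal y0.
  pose z := \sum_(m <- s | m == 0) f m.
  have z_wt : va_wt 0 z.
    by apply: (grading_fiber (va_grading U)) => m; case: (hf m).
  have z0 : pi z = 0.
    by rewrite /z (lin_sum pi_lin) big1 // => m _; case: (hf m).
  have psi_z : psi z = va_vac V.
    rewrite (lin_sum psi_lin).
    apply: (grading_component_homog (va_grading V)); last by rewrite -(lin_sum psi_lin) -def_y.
    + by move=> m; apply: lift_wt; case: (hf m).
    + exact: va_vac_wt.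
  have [c def_z] := universal_affine_wt0 hU z_wt.
  move: psi_z; rewrite def_z (linZ psi_lin) psi1 scaler0 -(va_morphism_vac hpi).
  by move/esym.
- by exists u.
Qed.

Lemma lift_trivial : is_trivial_deformation Y1.
Proof.
have ex v : exists u, pi u == v by have [u <-] := pi_surj v; exists u.
(* The choice of preimage is immaterial because [psi] vanishes on the kernel of [pi]. *)
pose phi v := psi (xchoose (ex v)).
have phiE u : phi (pi u) = psi u.
  apply/subr0_eq; rewrite -(linB psi_lin); apply: lift_ker.
  by rewrite (linB pi_lin) (eqP (xchooseP (ex (pi u)))) subrr.
have phi_lin : linear phi.
  move=> a v w; have [x <-] := pi_surj v; have [y <-] := pi_surj w.
  by rewrite -pi_lin !phiE psi_lin.
have phi1 : phi (va_vac V) = 0 by rewrite -(va_morphism_vac hpi) phiE.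
have phi_iota a : phi (iota a) = 0.
  rewrite iotaE phiE -[iotaU a]va_creation psiM psi1 (va_morphism_vac hpi).
  by rewrite (lin0 (va_mode_lin_r _ _)) (deformation_creation hY1) addr0.
(* The sign reconciles [coboundary_at] with the convention for trivial deformations. *)
exists (fun v => - phi v); split=> [a v w|n v Vv||u n v].
- by rewrite phi_lin opprD scalerN.
- rewrite -scaleN1r; apply: (subspaceZ (grading_subspace (va_grading V) n)).
  have [u Uu <-] := quotient_wt_surj hpi pi_surj Vv.
  by rewrite phiE; apply: lift_wt.
- by rewrite phi1 oppr0.
- rewrite opprK -!scaleN1r (linZ (va_mode_lin_l _ _)) (linZ (va_mode_lin_r _ _)) !scaleN1r.
  rewrite [X in X - _]addrC; move: n v.
  apply: (quotient_generated_ind hU hpi pi_surj iotaE (P := coboundary_at Y1 phi)).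
  + exact: coboundary_at_subspace.
  + exact: coboundary_at_vac.
  (* Since [phi (iota a) = 0], the condition at a generator is the recursion [psiM]. *)
  + move=> a n v; have [y <-] := pi_surj v.
    rewrite phi_iota (lin0 (va_mode_lin_l _ _)) subr0 -pi_mode !phiE psiM.
    by rewrite addrAC subrr add0r.
  + by move=> x n y; apply: coboundary_at_mode.
Qed.

End Lift.
End AffineDeformation.

Unset Implicit Arguments.
Set Strict Implicit.

Theorem theorem3p1 (R : realType) (g : vectType R[i]) (br : g -> g -> g)
    (hg : is_simple_lie br)
    (form : g -> g -> R[i]) (hform : is_normalized_form br form)
    (k : R)
    (V : vertexAlgebra R[i]) (iota : g -> V)
    (hV : is_simple_affine br form k%:C iota)
    (Y1 : V -> int -> V -> V) (hY1 : is_first_order_deformation Y1)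
    (hreg : forall (a b : g) (n : int), 0 <= n -> Y1 (iota a) n (iota b) = 0) :
  is_trivial_deformation Y1.
Proof.
have [U [iotaU [pi [hU hpi pi_surj hker iotaE]]]] := hV.
have [psi [psi_lin psi1 psiM]] := deformed_lift hU hpi pi_surj iotaE hY1 hreg.
exact: (lift_trivial hU hpi pi_surj hker iotaE hY1 psi_lin psi1 psiM).
Qed.
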